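(* Let $\alpha\in[0,1]$, let $G$ be a simple undirected graph on $n$ vertices, and let $H$ be a subgraph of $G$. Let $x\in\mathbb{R}^n$ and $\lambda\in\mathbb{R}$ satisfy $B(G)x=\lambda x$, and let $\lambda'$ be some scalar. Then the following are equivalent: (1) $B(H)x=\lambda' x$; (2) $B(G-H)x=(\lambda-\lambda')x$; (3) for all vertices $i$ of $G$, $$\alpha\sum_{j:\{i,j\}\in E(H)}x_j+(1-\alpha)\sum_{j:\{i,j\}\in E(H)}(x_i-x_j)=\lambda' x_i;$$ (4) for all vertices $i$ of $G$, $$\alpha\sum_{j:\{i,j\}\in E(G)\setminus E(H)}x_j+(1-\alpha)\sum_{j:\{i,j\}\in E(G)\setminus E(H)}(x_i-x_j)=(\lambda-\lambda')x_i.$$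
   Context: For a graph $G$ on $n$ vertices, $A(G)$ is the adjacency matrix, $D(G)$ the diagonal degree matrix, $L(G)=D(G)-A(G)$ the Laplacian, and $B(G)=B_\alpha(G)=\alpha A(G)+(1-\alpha)L(G)$. A subgraph $H$ of $G$ satisfies $V(H)\subseteq V(G)$ and $E(H)\subseteq E(G)$. $G-H$ denotes the graph with vertex set $V(G)$ obtained by removing the edges $E(H)$ from $E(G)$. $B(H)$ is regarded as an $n\times n$ matrix indexed by $V(G)$ (vertices of $G$ not in $H$ are treated as isolated), so that $B(G)=B(H)+B(G-H)$. *)

(* Defs.v *)
From HB Require Import structures.
From mathcomp Require Import all_boot all_order all_algebra.
From mathcomp Require Import reals.

Set Implicit Arguments.
Unset Strict Implicit.
Unset Printing Implicit Defensive.

Import Order.TTheory GRing.Theory Num.Theory.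

Local Open Scope ring_scope.

(* Simple undirected graphs whose vertices are labelled in 'I_n. The vertex set
   may be proper, so that a graph and its subgraphs inhabit the same type.
   Edges are two-element sets of vertices; in particular [set i; i] is never an
   edge. *)
Record graph (n : nat) := Graph {
  vset : {set 'I_n};
  eset : {set {set 'I_n}};
  esetP : forall e : {set 'I_n}, e \in eset -> (e \subset vset) && (#|e| == 2%N)
}.

Definition subgraph (n : nat) (H G : graph n) : Prop :=
  (vset H \subset vset G) /\ (eset H \subset eset G).

Lemma graph_diff_subproof (n : nat) (G H : graph n) (e : {set 'I_n}) :
  e \in eset G :\: eset H -> (e \subset vset G) && (#|e| == 2%N).
Proof. by case/setDP=> eG _; apply: esetP. Qed.

(* Only edges are removed: all vertices of G are kept. *)
Definition graph_diff (n : nat) (G H : graph n) : graph n :=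
  Graph (@graph_diff_subproof n G H).

Definition degree (n : nat) (G : graph n) (i : 'I_n) : nat :=
  #|[set j | [set i; j] \in eset G]|.

(* The matrices below are n x n whatever the vertex set is: labels outside
   [vset G] are treated as isolated vertices and give null rows and columns. *)
Definition adj_mx (R : realType) (n : nat) (G : graph n) : 'M[R]_n :=
  \matrix_(i, j) ([set i; j] \in eset G)%:R.

Definition deg_mx (R : realType) (n : nat) (G : graph n) : 'M[R]_n :=
  diag_mx (\row_i (degree G i)%:R).

Definition laplacian (R : realType) (n : nat) (G : graph n) : 'M[R]_n :=
  deg_mx R G - adj_mx R G.

Definition B_mx (R : realType) (n : nat) (alpha : R) (G : graph n) : 'M[R]_n :=
  alpha *: adj_mx R G + (1 - alpha) *: laplacian R G.

(* Main.v *)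
Require Import Defs.
From HB Require Import structures.
From mathcomp Require Import all_boot all_order all_algebra.
From mathcomp Require Import reals.

Set Implicit Arguments.
Unset Strict Implicit.
Unset Printing Implicit Defensive.

Import Order.TTheory GRing.Theory Num.Theory.

Local Open Scope ring_scope.

(** The edges of [G] split disjointly into those of [H] and those of [graph_diff G H], and adjacency
    and degree, hence [B_mx], are additive over this split ([B_mxD]). So the two vectors in (1) and
    (2) sum to [lambda *: x], and fixing one fixes the other. Conditions (3) and (4) are (1) and (2)
    read coordinatewise ([B_mx_eigenP]). *)

Lemma adj_mxD (R : realType) (n : nat) (G H : graph n) :
  subgraph H G -> adj_mx R G = adj_mx R H + adj_mx R (graph_diff G H).
Proof.
case=> _ sHG; apply/matrixP=> i j; rewrite !mxE /= inE.
(* The inclusion excludes an edge of [H] outside [G], for which the identity would read 0 = 1 +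
   0. *)
have := subsetP sHG [set i; j].
case: (_ \in eset H) => [-> //|_]; first by rewrite addr0.
by rewrite add0r.
Qed.

(** Turns degrees into row sums, so that their additivity follows from that of [adj_mx]. *)
Lemma natr_degree (R : realType) (n : nat) (G : graph n) (i : 'I_n) :
  (degree G i)%:R = \sum_j adj_mx R G i j.
Proof.
rewrite /degree -sum1_card natr_sum big_mkcond /=.
by apply: eq_bigr => j _; rewrite inE mxE; case: ifP.
Qed.

Lemma deg_mxD (R : realType) (n : nat) (G H : graph n) :
  subgraph H G -> deg_mx R G = deg_mx R H + deg_mx R (graph_diff G H).
Proof.
move=> sHG; rewrite /deg_mx -raddfD; congr diag_mx; apply/rowP=> i.
rewrite !mxE !natr_degree -big_split (adj_mxD R sHG).
by apply: eq_bigr => j _; rewrite mxE.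
Qed.

Lemma B_mxD (R : realType) (n : nat) (alpha : R) (G H : graph n) :
  subgraph H G -> B_mx alpha G = B_mx alpha H + B_mx alpha (graph_diff G H).
Proof.
move=> sHG; rewrite /B_mx /laplacian (adj_mxD R sHG) (deg_mxD R sHG).
by rewrite opprD addrACA !scalerDr addrACA.
Qed.

(** The degree term contributes one copy of [x i 0] per neighbour of [i], which pairs with [- x j 0]
    from the adjacency term. *)
Lemma B_mx_mulE (R : realType) (n : nat) (alpha : R) (G : graph n)
    (x : 'cV[R]_n) (i : 'I_n) :
  (B_mx alpha G *m x) i 0 =
    alpha * (\sum_(j | [set i; j] \in eset G) x j 0)
    + (1 - alpha) * (\sum_(j | [set i; j] \in eset G) (x i 0 - x j 0)).
Proof.
have adjE : (adj_mx R G *m x) i 0 = \sum_(j | [set i; j] \in eset G) x j 0.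
  rewrite mxE [RHS]big_mkcond; apply: eq_bigr => j _.
  by rewrite mxE; case: ifP; rewrite ?mul1r ?mul0r.
have degE : (deg_mx R G *m x) i 0 = \sum_(j | [set i; j] \in eset G) x i 0.
  rewrite mul_diag_mx !mxE natr_degree mulr_suml [RHS]big_mkcond.
  by apply: eq_bigr => j _; rewrite mxE; case: ifP; rewrite ?mul1r ?mul0r.
rewrite /B_mx /laplacian mulmxDl -!scalemxAl mulmxBl sumrB -adjE -degE.
by rewrite !mxE.
Qed.

Lemma B_mx_eigenP (R : realType) (n : nat) (alpha : R) (G : graph n)
    (x : 'cV[R]_n) (mu : R) :
  B_mx alpha G *m x = mu *: x <->
  forall i : 'I_n,
    alpha * (\sum_(j | [set i; j] \in eset G) x j 0)
    + (1 - alpha) * (\sum_(j | [set i; j] \in eset G) (x i 0 - x j 0))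
    = mu * x i 0.
Proof.
split=> [Bx i|Bx]; first by rewrite -B_mx_mulE Bx mxE.
by apply/colP=> i; rewrite B_mx_mulE Bx mxE.
Qed.

Theorem theorem3p4 (R : realType) (n : nat) (alpha : R)
    (halpha : 0 <= alpha <= 1)
    (G H : graph n) (hG : vset G = [set: 'I_n]) (hHG : subgraph H G)
    (x : 'cV[R]_n) (lambda lambda' : R)
    (hx : B_mx alpha G *m x = lambda *: x) :
  [<-> B_mx alpha H *m x = lambda' *: x;
       B_mx alpha (graph_diff G H) *m x = (lambda - lambda') *: x;
       forall i : 'I_n, i \in vset G ->
         alpha * (\sum_(j : 'I_n | [set i; j] \in eset H) x j 0)
         + (1 - alpha) * (\sum_(j : 'I_n | [set i; j] \in eset H) (x i 0 - x j 0))
         = lambda' * x i 0;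
       forall i : 'I_n, i \in vset G ->
         alpha * (\sum_(j : 'I_n | [set i; j] \in eset G :\: eset H) x j 0)
         + (1 - alpha) *
             (\sum_(j : 'I_n | [set i; j] \in eset G :\: eset H) (x i 0 - x j 0))
         = (lambda - lambda') * x i 0].
Proof.
have BG : B_mx alpha H *m x + B_mx alpha (graph_diff G H) *m x = lambda *: x.
  by rewrite -mulmxDl -B_mxD.
have BHP : B_mx alpha H *m x = lambda' *: x <->
    B_mx alpha (graph_diff G H) *m x = (lambda - lambda') *: x.
  (* With [lambda *: x] replaced by the sum in [BG], the [graph_diff] term cancels from both
     sides. *)
  rewrite scalerBl -BG; split=> [->|]; first by rewrite addrC addKr.
  by rewrite addrAC => /esym/(canRL (addrK _)); rewrite subrr => /subr0_eq.
(* Since [G] uses every label, (3) and (4) cover all coordinates of [x]. *)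
have vG i : i \in vset G by rewrite hG inE.
tfae.
- by move=> /BHP.
- by move=> /BHP /B_mx_eigenP eH i _; apply: eH.
(* The edge set of [graph_diff G H] is [eset G :\: eset H] by conversion. *)
- move=> eH i _; apply: (B_mx_eigenP alpha (graph_diff G H) x _).1 i.
  by apply/BHP/B_mx_eigenP => i; apply: eH.
- by move=> eGH; apply/BHP/B_mx_eigenP => i; apply: eGH.
Qed.
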